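(* Let $n\ge 1$ and $1\le k\le n$ be integers. The functions $f\colon \mathcal{T}_{n,k}^+\to \mathcal{S}_{n,k}^-$, $f(T)=\overline{T_1}\,T_2$, and $g\colon \mathcal{S}_{n,k}^-\to \mathcal{T}_{n,k}^+$, $g(S)=\overline{S_1}\,S_2$, are inverses of each other, where $T=T_1T_2$ (respectively $S=S_1S_2$) is the factorization in which $T_1$ (respectively $S_1$) is the smallest balanced initial subsequence of $T$ (respectively $S$), and the overline denotes termwise negation.
   Context: Let $\mathcal{S}_n=\{s_1\cdots s_{2n} : s_i\in\{-1,+1\}\}$ be the set of $\pm1$ sequences of length $2n$. For $S=s_1\cdots s_{2n}\in\mathcal{S}_n$ put $\sigma_i(S)=\sum_{j=1}^i s_j$ for $1\le i\le 2n$, and $\sum S=\sigma_{2n}(S)$. The sequence $S$ is positive if $\sigma_i(S)>0$ for all $1\le i\le 2n$; $\mathcal{P}_n$ is the set of positive sequences in $\mathcal{S}_n$. For $1\le k\le n$: - $\mathcal{S}_{n,k}^+$ is the set of $S\in\mathcal{S}_n$ with $s_1=+1$ and $\sum S=2k$; - $\mathcal{S}_{n,k}^-$ is the set of $S\in\mathcal{S}_n$ with $s_1=-1$ and $\sum S=2k$; - $\mathcal{P}_{n,k}$ is the set of $P\in\mathcal{P}_n$ with $\sum P=2k$; - $\mathcal{T}_{n,k}^+=\mathcal{S}_{n,k}^+\setminus\mathcal{P}_{n,k}$. The smallest balanced initial subsequence of a sequence $S$ is the initial segment $s_1\cdots s_m$, where $m\ge1$ is the least index with $\sigma_m(S)=0$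 (such an $m$ exists for every element of $\mathcal{T}_{n,k}^+$ and of $\mathcal{S}_{n,k}^-$). Writing $S=S_1S_2$ with $S_1=s_1\cdots s_m$ and $S_2=s_{m+1}\cdots s_{2n}$, the sequence $\overline{S_1}$ is $(-s_1)\cdots(-s_m)$, and $\overline{S_1}\,S_2$ is the concatenation. *)

(* Defs.v *)
From mathcomp Require Import all_boot all_order all_algebra.

Set Implicit Arguments.
Unset Strict Implicit.
Unset Printing Implicit Defensive.

Import Order.TTheory GRing.Theory Num.Theory.

Local Open Scope ring_scope.

(* Terms are numbered from 0: the term s_(j+1) of S is S`_j. *)
Definition sigma (S : seq int) (i : nat) : int := \sum_(j < i) S`_j.

Definition pm1_seq (n : nat) : {pred (2 * n).-tuple int} :=
  [pred S : (2 * n).-tuple int | all (fun s : int => (s == -1) || (s == 1)) S].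
Arguments pm1_seq : clear implicits.

Definition total (n : nat) (S : (2 * n).-tuple int) : int := sigma S (2 * n)%N.

Definition positive_seq (n : nat) : {pred (2 * n).-tuple int} :=
  [pred S : (2 * n).-tuple int |
    (S \in pm1_seq n) && [forall i : 'I_(2 * n), 0 < sigma S i.+1]].
Arguments positive_seq : clear implicits.

Definition Splus (n k : nat) : {pred (2 * n).-tuple int} :=
  [pred S : (2 * n).-tuple int |
    [&& S \in pm1_seq n, S`_0 == 1 & total S == (2 * k)%N%:Z]].
Arguments Splus : clear implicits.

Definition Sminus (n k : nat) : {pred (2 * n).-tuple int} :=
  [pred S : (2 * n).-tuple int |
    [&& S \in pm1_seq n, S`_0 == -1 & total S == (2 * k)%N%:Z]].
Arguments Sminus : clear implicits.

Definition Pos (n k : nat) : {pred (2 * n).-tuple int} :=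
  [pred P : (2 * n).-tuple int |
    (P \in positive_seq n) && (total P == (2 * k)%N%:Z)].
Arguments Pos : clear implicits.

Definition Tplus (n k : nat) : {pred (2 * n).-tuple int} :=
  [predD Splus n k & Pos n k].
Arguments Tplus : clear implicits.

Definition smallest_balanced_initial (S S1 : seq int) : Prop :=
  exists m : nat,
    [/\ (1 <= m <= size S)%N,
        sigma S m = 0,
        forall i : nat, (1 <= i < m)%N -> sigma S i <> 0
      & S1 = take m S].

(* The graph of S1 S2 |-> (-S1) S2. It determines S' from S, since m above is
   unique; it relates S to nothing if no nonempty initial segment is balanced. *)
Definition negates_smallest_balanced (S S' : seq int) : Prop :=
  exists S1 S2 : seq int,
    [/\ S = S1 ++ S2,
        smallest_balanced_initial S S1
      & S' = [seq - s | s <- S1] ++ S2].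

(* Main.v *)
Require Import Defs.
From mathcomp Require Import all_boot all_order all_algebra.

(** Both maps are restrictions of a single operation on sequences: negate the
    terms up to the first balanced position m.  Two facts make it work.

    - It is an involution where a balanced position exists.  Since
      [sigma S m = 0], the partial sums of the new sequence are [- sigma S i]
      up to m and [sigma S i] afterwards, so the two sequences have the same
      balanced positions ([balanced_flip]), hence the same first one, and
      negating the same prefix twice restores S ([flipK]).

    - A balanced position exists on both sides.  The total 2k is nonnegative
      and some earlier partial sum is nonpositive: the first one when
      [s_1 = -1], and one witnessing the failure of positivity for an element
      of [Tplus].  As partial sums move by unit steps, one of them vanishes in
      between ([sigma_ivt]).

    Finally the operation keeps the total and changes the sign of the first
    term, and the balanced position that it keeps prevents its values from
    being positive sequences; so it exchanges [Tplus] and [Sminus]. *)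

Set Implicit Arguments.
Unset Strict Implicit.
Unset Printing Implicit Defensive.

Import Order.TTheory GRing.Theory Num.Theory.

Local Open Scope ring_scope.

Definition pm1 : pred int := fun s => (s == -1) || (s == 1).

Lemma pm1N s : pm1 (- s) = pm1 s.
Proof. by rewrite /pm1 eqr_opp orbC eqr_oppLR. Qed.

Lemma subr_mul2n (V : zmodType) (x : V) : x - x *+ 2 = - x.
Proof. by rewrite mulr2n opprD addrA subrr add0r. Qed.

Lemma sigma_recr S i : sigma S i.+1 = sigma S i + S`_i.
Proof. by rewrite /sigma big_ord_recr. Qed.

(** A discrete intermediate value theorem: a walk with steps -1 and 1 cannot
    jump over 0.  At the step that takes it from a negative value to a
    nonnegative one, that value is 0, since the step adds at most 1. *)
Lemma sigma_ivt S a b : all pm1 S -> (a <= b <= size S)%N ->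
  sigma S a <= 0 -> 0 <= sigma S b ->
  exists2 i, (a <= i <= b)%N & sigma S i = 0.
Proof.
move=> pmS /andP[le_ab le_bS] Sa_le0.
elim: b le_ab le_bS => [|b IHb] le_ab le_bS Sb_ge0.
  exists 0%N; first by rewrite leqnn andbT.
  by rewrite /sigma big_ord0.
have [eq_ab|ne_ab] := eqVneq a b.+1.
  exists a; first by rewrite leqnn.
  by apply/eqP; rewrite eq_le Sa_le0 eq_ab.
have {ne_ab}le_ab' : (a <= b)%N by rewrite -ltnS ltn_neqAle ne_ab.
have [Sb_ge0'|Sb_lt0] := leP 0 (sigma S b).
  have [i /andP[le_ai le_ib] Si0] := IHb le_ab' (ltnW le_bS) Sb_ge0'.
  by exists i; rewrite // le_ai leqW.
exists b.+1; first by rewrite le_ab leqnn.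
apply/eqP; rewrite eq_le Sb_ge0 andbT sigma_recr.
have step_le1 : S`_b <= 1.
  by have /orP[] := all_nthP 0 pmS b le_bS => /eqP->.
apply: le_trans (lerD (lexx _) step_le1) _.
by rewrite lezD1.
Qed.

Definition negate_prefix m (S : seq int) : seq int :=
  [seq - s | s <- take m S] ++ drop m S.

Lemma size_negate_prefix m S : size (negate_prefix m S) = size S.
Proof. by rewrite size_cat size_map -size_cat cat_take_drop. Qed.

Lemma negate_prefixK m : involutive (negate_prefix m).
Proof.
move=> S; rewrite /negate_prefix.
have [le_mS|/ltnW le_Sm] := leqP m (size S).
  have sz : size [seq - s | s <- take m S] = m by rewrite size_map size_takel.
  by rewrite take_size_cat // drop_size_cat // (mapK opprK) cat_take_drop.
rewrite (take_oversize le_Sm) (drop_oversize le_Sm) cats0.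
by rewrite take_oversize ?drop_oversize ?size_map // cats0 (mapK opprK).
Qed.

Lemma all_pm1_negate_prefix m S :
  all pm1 (negate_prefix m S) = all pm1 S.
Proof.
rewrite all_cat all_map (eq_all (a2 := pm1)); last exact: pm1N.
by rewrite -all_cat cat_take_drop.
Qed.

Lemma nth_negate_prefix m S i :
  (negate_prefix m S)`_i = if (i < m)%N then - S`_i else S`_i.
Proof.
have [le_Si|lt_iS] := leqP (size S) i.
  by rewrite !nth_default ?size_negate_prefix ?oppr0 ?if_same.
rewrite nth_cat size_map size_take_min leq_min lt_iS andbT.
have [lt_im|le_mi] := ltnP i m.
  by rewrite (nth_map 0) ?nth_take // size_take_min leq_min lt_im.
by rewrite nth_drop (minn_idPl (leq_trans le_mi (ltnW lt_iS))) subnKC.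
Qed.

Lemma sigma_negate_prefix m S i :
  sigma (negate_prefix m S) i = sigma S i - sigma S (minn i m) *+ 2.
Proof.
elim: i => [|i IHi]; first by rewrite min0n /sigma !big_ord0 mul0rn subr0.
rewrite !sigma_recr IHi nth_negate_prefix.
have [lt_im|le_mi] := ltnP i m.
  rewrite (minn_idPl lt_im) sigma_recr.
  by rewrite !subr_mul2n opprD.
by rewrite (minn_idPr (leqW le_mi)) addrAC.
Qed.

Definition balanced S : pred nat := fun i => sigma S i == 0.

Definition has_balance S : bool := has (balanced S) (iota 1 (size S)).

(** The successor turns an index in [iota 1 _] into the position stored there;
    the value is [(size S).+1] when no position is balanced. *)
Definition first_balance S : nat := (find (balanced S) (iota 1 (size S))).+1.

Lemma has_balanceP S :
  reflect (exists2 i, (1 <= i <= size S)%N & sigma S i = 0) (has_balance S).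
Proof.
apply: (iffP hasP) => [[i]|[i bnd_i Si0]].
  by rewrite mem_iota add1n ltnS => bnd_i /eqP; exists i.
by exists i; [rewrite mem_iota add1n ltnS | apply/eqP].
Qed.

Lemma first_balance_le S : has_balance S -> (first_balance S <= size S)%N.
Proof. by rewrite /has_balance has_find size_iota. Qed.

Lemma sigma_first_balance S : has_balance S -> sigma S (first_balance S) = 0.
Proof.
move=> balS; have := nth_find 0%N balS; rewrite nth_iota; last first.
  exact: first_balance_le.
by rewrite add1n => /eqP.
Qed.

Lemma smallest_balanced_initial_take S : has_balance S ->
  smallest_balanced_initial S (take (first_balance S) S).
Proof.
move=> balS; have le_fS := first_balance_le balS.
exists (first_balance S); split=> //; first exact: sigma_first_balance.
case=> // i /= lt_i_f Si0.
have /(before_find 0%N) : (i < find (balanced S) (iota 1 (size S)))%N by [].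
by rewrite nth_iota ?(leq_trans (ltnW lt_i_f)) // /balanced add1n Si0 eqxx.
Qed.

Definition flip S : seq int := negate_prefix (first_balance S) S.

Lemma size_flip S : size (flip S) = size S.
Proof. exact: size_negate_prefix. Qed.

Lemma negates_smallest_balanced_flip S : has_balance S ->
  negates_smallest_balanced S (flip S).
Proof.
move=> balS; exists (take (first_balance S) S), (drop (first_balance S) S).
by split=> //; [rewrite cat_take_drop | apply: smallest_balanced_initial_take].
Qed.

Lemma nth0_flip S : (flip S)`_0 = - S`_0.
Proof. by rewrite nth_negate_prefix. Qed.

Lemma sigma_flip S i : has_balance S ->
  sigma (flip S) i = if (i <= first_balance S)%N then - sigma S i else sigma S i.
Proof.
move=> balS; rewrite sigma_negate_prefix; case: leqP => _.
  exact: subr_mul2n.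
by rewrite sigma_first_balance // mul0rn subr0.
Qed.

Lemma balanced_flip S : has_balance S -> balanced (flip S) =1 balanced S.
Proof.
move=> balS i; rewrite /balanced sigma_flip //.
by case: ifP; rewrite ?oppr_eq0.
Qed.

Lemma sigma_flip_size S : has_balance S ->
  sigma (flip S) (size S) = sigma S (size S).
Proof.
move=> balS; rewrite sigma_flip //; case: ifP => // le_Sf.
have eq_fS : first_balance S = size S.
  by apply/eqP; rewrite eqn_leq first_balance_le.
by rewrite -eq_fS sigma_first_balance // oppr0.
Qed.

Lemma has_balance_flip S : has_balance S -> has_balance (flip S).
Proof.
by move=> balS; rewrite /has_balance size_flip (eq_has (balanced_flip balS)).
Qed.

(** The second flip negates the same prefix as the first, because [flip]
    keeps the set of balanced positions. *)
Lemma flipK S : has_balance S -> flip (flip S) = S.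
Proof.
move=> balS; rewrite {1}/flip /first_balance size_flip.
by rewrite (eq_find (balanced_flip balS)) negate_prefixK.
Qed.

(** The common reason why a balanced position exists in both sets: the two
    differ only in which index a is available. *)
Lemma has_balance_of_le0 S a : all pm1 S -> (1 <= a <= size S)%N ->
  sigma S a <= 0 -> 0 <= sigma S (size S) -> has_balance S.
Proof.
move=> pmS /andP[a_gt0 le_aS] Sa_le0 tot_ge0.
have [|i /andP[le_ai le_iS] Si0] := sigma_ivt pmS _ Sa_le0 tot_ge0.
  by rewrite le_aS leqnn.
by apply/has_balanceP; exists i; rewrite // le_iS (leq_trans a_gt0).
Qed.

(** Transported along [size S = N] because the maps of the theorem must land
    in tuples of the same declared length. *)
Definition flip_tuple N (S : N.-tuple int) : N.-tuple int :=
  tcast (size_tuple S) (Tuple (introT eqP (size_flip S))).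

Lemma val_flip_tuple N (S : N.-tuple int) : flip_tuple S = flip S :> seq int.
Proof. by rewrite val_tcast. Qed.

Lemma flip_tupleK N (S : N.-tuple int) : has_balance S ->
  flip_tuple (flip_tuple S) = S.
Proof. by move=> balS; apply: val_inj; rewrite /= !val_flip_tuple flipK. Qed.

Section Exchange.

Variables n k : nat.
Implicit Types S T : (2 * n).-tuple int.

Lemma pm1_seq_flip S : (flip_tuple S \in pm1_seq n) = (S \in pm1_seq n).
Proof. by rewrite !inE val_flip_tuple all_pm1_negate_prefix. Qed.

Lemma total_flip S : has_balance S -> Defs.total (flip_tuple S) = Defs.total S.
Proof.
move=> balS; rewrite /Defs.total val_flip_tuple.
by have := sigma_flip_size balS; rewrite size_tuple.
Qed.

Lemma positive_seq_no_balance S : S \in positive_seq n -> ~~ has_balance S.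
Proof.
rewrite inE => /andP[_ /forallP posS]; apply/has_balanceP => -[[//|i]].
rewrite size_tuple => /= lt_in Si0.
by have := posS (Ordinal lt_in); rewrite /= Si0 ltxx.
Qed.

Lemma Sminus_has_balance S : (1 <= n)%N -> S \in Sminus n k -> has_balance S.
Proof.
move=> n_gt0; rewrite inE => /and3P[pmS /eqP S0 /eqP totS].
apply: (has_balance_of_le0 (a := 1)) => //.
- by rewrite size_tuple muln_gt0.
- by rewrite sigma_recr /sigma big_ord0 add0r S0.
- by rewrite size_tuple -/(Defs.total S) totS.
Qed.

Lemma Tplus_has_balance T : T \in Tplus n k -> has_balance T.
Proof.
rewrite !inE => /andP[nposT /and3P[pmT _ totT]].
move: nposT; rewrite pmT totT andbT /= => /forallPn[i].
rewrite -leNgt => Ti_le0; apply: (has_balance_of_le0 _ _ Ti_le0) => //.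
  by rewrite size_tuple /=.
by rewrite size_tuple -/(Defs.total T) (eqP totT).
Qed.

Lemma flip_Tplus T : T \in Tplus n k -> flip_tuple T \in Sminus n k.
Proof.
move=> TT; have balT := Tplus_has_balance TT.
have /andP[_ /and3P[pmT /eqP T0 totT]] := TT.
by apply/and3P; rewrite pm1_seq_flip total_flip // val_flip_tuple nth0_flip T0.
Qed.

Lemma flip_Sminus S : (1 <= n)%N ->
  S \in Sminus n k -> flip_tuple S \in Tplus n k.
Proof.
move=> n_gt0 SS; have balS := Sminus_has_balance n_gt0 SS.
have /and3P[pmS /eqP S0 totS] := SS.
apply/andP; split; last first.
  by apply/and3P; rewrite pm1_seq_flip total_flip // val_flip_tuple nth0_flip S0.
apply/negP => /andP[/positive_seq_no_balance /negP[]].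
by rewrite val_flip_tuple has_balance_flip.
Qed.

End Exchange.

Local Close Scope ring_scope.

Theorem theorem1 (n k : nat) (hn : (1 <= n)%N) (hk : (1 <= k <= n)%N) :
  exists (f : {T | T \in Tplus n k} -> {S | S \in Sminus n k})
         (g : {S | S \in Sminus n k} -> {T | T \in Tplus n k}),
    [/\ forall T : {T | T \in Tplus n k},
          negates_smallest_balanced (val T) (val (f T)),
        forall S : {S | S \in Sminus n k},
          negates_smallest_balanced (val S) (val (g S)),
        cancel f g
      & cancel g f].
Proof.
exists (fun T => exist _ (flip_tuple (val T)) (flip_Tplus (valP T))).
exists (fun S => exist _ (flip_tuple (val S)) (flip_Sminus hn (valP S))).
split=> [[T TT]|[S SS]|[T TT]|[S SS]] /=.
- rewrite val_flip_tuple; apply: negates_smallest_balanced_flip.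
  exact: Tplus_has_balance TT.
- rewrite val_flip_tuple; apply: negates_smallest_balanced_flip.
  exact: Sminus_has_balance SS.
- by apply: val_inj; apply: flip_tupleK (Tplus_has_balance TT).
- by apply: val_inj; apply: flip_tupleK (Sminus_has_balance hn SS).
Qed.
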